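(* Let $V$ be a real Hilbert space, let $a:V\times V\to\mathbb{R}$ be a bilinear form for which there exist constants $M,\alpha>0$ with $$|a(w,v)|\le M\|w\|_V\|v\|_V,\qquad a(v,v)\ge\alpha\|v\|_V^2\qquad\text{for all }w,v\in V,$$ and let $F:V\to\mathbb{R}$ be a bounded linear functional. Let $u^*\in V$ be the unique solution of $a(u^*,v)=F(v)$ for all $v\in V$. Let $V_{\mathrm{RF}}\subset V$ be a (finite-dimensional) linear subspace and let $u_{\mathrm{RF}}\in V_{\mathrm{RF}}$ satisfy $a(u_{\mathrm{RF}},v)=F(v)$ for all $v\in V_{\mathrm{RF}}$. Then $$\|u^*-u_{\mathrm{RF}}\|_V\le\frac{M}{\alpha}\inf_{w\in V_{\mathrm{RF}}}\|u^*-w\|_V.$$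
   Context: In the paper $V_{\mathrm{RF}}$ is the span of finitely many sampled random feature functions; the statement does not use the particular realization. *)

(* Defs.v *)
From HB Require Import structures.
From mathcomp Require Import all_boot all_order all_algebra.
From mathcomp Require Import all_classical all_reals all_analysis.
Set Implicit Arguments.
Unset Strict Implicit.
Unset Printing Implicit Defensive.
Import Order.TTheory GRing.Theory Num.Theory.
Import numFieldNormedType.Exports.
Local Open Scope classical_set_scope.
Local Open Scope ring_scope.

(* Over the reals a {dot V for idfun} is a bilinear, symmetric, positive
   definite form; completeness comes from completeNormedModType. *)
HB.mixin Record isHilbert (R : realType) V of CompleteNormedModule R V := {
  inner : {dot V for @idfun R} ;
  innerE : forall v : V, inner v v = `|v| ^+ 2
}.

#[short(type="hilbertType")]
HB.structure Definition Hilbert (R : realType) :=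
  {V of CompleteNormedModule R V & isHilbert R V}.

Definition bounded_bilinear (R : realType) (V : normedModType R)
    (a : V -> V -> R) (M : R) : Prop :=
  forall w v : V, `|a w v| <= M * `|w| * `|v|.

Definition coercive (R : realType) (V : normedModType R)
    (a : V -> V -> R) (alpha : R) : Prop :=
  forall v : V, alpha * `|v| ^+ 2 <= a v v.

Definition bounded_functional (R : realType) (V : normedModType R)
    (F : V -> R) : Prop :=
  exists C : R, forall v : V, `|F v| <= C * `|v|.

Definition finite_dimensional (R : realType) (V : lmodType R)
    (W : set V) : Prop :=
  exists (n : nat) (e : 'I_n -> V),
    W = [set v | exists c : 'I_n -> R, v = \sum_i c i *: e i].

(* Main.v *)
(* Galerkin orthogonality [a (u* - u_RF) v = 0] for [v] in [V_RF] lets the second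
   argument of [a (u* - u_RF) (u* - u_RF)] be replaced by [u* - w] for any [w] in
   [V_RF]; coercivity bounds this number from below and continuity from above. *)
Require Import Defs.
From HB Require Import structures.
From mathcomp Require Import all_boot all_order all_algebra.
From mathcomp Require Import all_classical all_reals all_analysis.
Set Implicit Arguments.
Unset Strict Implicit.
Unset Printing Implicit Defensive.
Import Order.TTheory GRing.Theory Num.Theory.
Import numFieldNormedType.Exports.
Local Open Scope classical_set_scope.
Local Open Scope ring_scope.

Lemma galerkin_orthogonality (R : realType) (V : normedModType R)
    (a : {biscalar V}) (F : V -> R) (W : set V) (u uW v : V) :
  (forall x, a u x = F x) -> (forall x, W x -> a uW x = F x) ->
  W v -> a (u - uW) v = 0.
Proof. by move=> au auW Wv; rewrite linearBl /= au auW// subrr. Qed.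

(** The lower bound is quadratic in the norm of [e] and the upper bound linear in it, so one factor
    cancels. *)
Lemma coercive_quasi_optimal (R : realType) (V : normedModType R)
    (a : {biscalar V}) (M alpha : R) (e d : V) :
  0 < M -> 0 < alpha -> bounded_bilinear a M -> coercive a alpha ->
  a e e = a e d -> `|e| <= M / alpha * `|d|.
Proof.
move=> M0 alpha0 aM aalpha aed.
(* The cancellation needs [e] nonzero. *)
have [->|e0] := eqVneq e 0.
  by rewrite normr0 mulr_ge0// divr_ge0// ltW.
rewrite mulrAC ler_pdivlMr// mulrC -(ler_pM2r (x := `|e|)) ?normr_gt0//.
rewrite -mulrA -expr2 mulrAC (le_trans (aalpha e))// aed.
exact: le_trans (ler_norm _) (aM e d).
Qed.

Theorem theorem4p3 (R : realType) (V : hilbertType R)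
    (a : {biscalar V}) (M alpha : R) (F : {scalar V})
    (ustar : V) (VRF : set V) (uRF : V) :
  0 < M -> 0 < alpha ->
  bounded_bilinear a M -> coercive a alpha ->
  bounded_functional F ->
  (forall v : V, a ustar v = F v) ->
  submod_closed (mem VRF) -> finite_dimensional VRF ->
  VRF uRF -> (forall v : V, VRF v -> a uRF v = F v) ->
  `|ustar - uRF| <= M / alpha * inf [set `|ustar - w| | w in VRF].
Proof.
move=> M0 alpha0 aM aalpha _ austar VRF_submod _ VRFu auRF.
(* With the constant moved left, it suffices to bound every distance from below; [uRF] shows that
   the set of distances is nonempty. *)
rewrite mulrC -ler_pdivrMr ?divr_gt0//.
apply: lb_le_inf; first by exists `|ustar - uRF|, uRF.
move=> _ [w VRFw <-].
rewrite ler_pdivrMr ?divr_gt0// mulrC.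
apply: coercive_quasi_optimal => //.
(* This difference is the admissible test vector for Galerkin orthogonality. *)
have VRFwu : VRF (w - uRF).
  have [_ lin] := VRF_submod.
  have := lin (-1) uRF w (mem_set VRFu) (mem_set VRFw).
  by rewrite scaleN1r addrC => /set_mem.
(* Split the error at [w]; the second term vanishes by orthogonality. *)
have -> : a (ustar - uRF) (ustar - uRF) =
    a (ustar - uRF) (ustar - w) + a (ustar - uRF) (w - uRF).
  by rewrite -linearDr /= addrA subrK.
by rewrite (galerkin_orthogonality austar auRF VRFwu) addr0.
Qed.
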